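(* Let $R$ be an arbitrary (associative and commutative) radically Noetherian domain containing the field of rational numbers $\mathbb{Q}=\mathbb{Q}\cdot 1\subseteq R$, and let $m\ge 1$. Then (a) the left-symmetric Witt algebra $L_m$ over $R$ is equationally Noetherian; (b) the Witt algebra $W_m$ over $R$ is equationally Noetherian.
   Context: $R$ has identity; it is radically Noetherian if it satisfies the ascending chain condition on radical (radically closed) ideals. $L_m$ and $W_m$: let $C_m=R[x_1,\ldots,x_m]$ with $\delta_i=\partial/\partial x_i$, and let $B$ be the free left $C_m$-module of formal sums $f_1\delta_1+\cdots+f_m\delta_m$, $f_i\in C_m$. $L_m$ is the $R$-algebra $\langle B,\circ\rangle$ with $R$-bilinear product determined by $f\delta_i\circ g\delta_j=f\,\delta_i(g)\,\delta_j$ ($f,g\in C_m$); $W_m$ is the Lie $R$-algebra $\langle B,[\cdot,\cdot]\rangle$ with $[u,v]=u\circ v-v\circ u$. Equationally Noetherian: let $A$ be an $R$-algebra and $\mathfrak{M}$ a variety of $R$-algebras with $A\in\mathfrak{M}$. For $k\ge 1$ let $\mathfrak{M}\langle z_1,\ldots,z_k\rangle$ be the free algebra of $\mathfrak{M}$ on $z_1,\ldots,z_k$, and let $D=A\sqcup_{\mathfrak{M}}\mathfrak{M}\langle z_1,\ldots,z_k\rangle$ be the coproduct in $\mathfrak{M}$ (only varieties for which both canonical maps into $D$ are injective are considered). For $f\in D$ and $(a_1,\ldots,a_k)\in A^k$ put $f(a_1,\ldots,a_k)=\phi(f)$, where $\phi:D\to A$ is the unique homomorphism that is the identity on $A$ and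 sends $z_i$ to $a_i$. For $S\subseteq D$ put $Z(S)=\{a\in A^k : f(a)=0 \text{ for all } f\in S\}$. The sets $Z(S)$ define (as a subbasis of closed sets) the Zariski topology on $A^k$. $A$ is equationally Noetherian if $A^k$ is a Noetherian topological space for every $k\ge1$; equivalently, for every $k$ and every $S\subseteq D$ there is a finite $S_0\subseteq S$ with $Z(S)=Z(S_0)$. This does not depend on the choice of $\mathfrak{M}$ containing $A$ (one may take the variety generated by $A$). *)

(* Defs.v *)
From HB Require Import structures.
From mathcomp Require Import all_boot all_order all_algebra sesquilinear.
From mathcomp Require Import finmap boolp classical_sets topology.
From mathcomp Require Import mpoly.

Set Implicit Arguments.
Unset Strict Implicit.
Unset Printing Implicit Defensive.

Import GRing.Theory.
Local Open Scope classical_set_scope.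
Local Open Scope ring_scope.

Definition is_ideal (R : comNzRingType) (I : set R) : Prop :=
  [/\ I 0, forall x y, I x -> I y -> I (x + y) & forall a x, I x -> I (a * x)].

Definition is_radical_ideal (R : comNzRingType) (I : set R) : Prop :=
  is_ideal I /\ forall x n, I (x ^+ n) -> I x.

Definition radically_noetherian (R : comNzRingType) : Prop :=
  forall I : nat -> set R, (forall n, is_radical_ideal (I n)) ->
  (forall n, I n `<=` I n.+1) -> exists N, forall n, (N <= n)%N -> I n = I N.

(* An R-algebra need be neither associative nor unital, and homomorphisms are
   not asked to preserve a unit. *)
Record nalgebra (R : comNzRingType) := NAlgebra {
  nalg_sort :> lmodType R;
  nalg_mul : {bilinear nalg_sort -> nalg_sort -> nalg_sort} }.

Definition nalg_hom (R : comNzRingType) (A B : nalgebra R) (f : A -> B) : Prop :=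
  linear f /\ forall x y, f (nalg_mul A x y) = nalg_mul B (f x) (f y).

Inductive nterm (R : Type) (X : Type) : Type :=
| TVar of X
| TZero
| TAdd of nterm R X & nterm R X
| TScale of R & nterm R X
| TMul of nterm R X & nterm R X.
Arguments TZero {R X}.
Arguments TVar {R X}.

Fixpoint teval (R : comNzRingType) (X : Type) (A : nalgebra R) (v : X -> A)
    (t : nterm R X) : A :=
  match t with
  | TVar x => v x
  | TZero => 0
  | TAdd t1 t2 => teval v t1 + teval v t2
  | TScale c t1 => c *: teval v t1
  | TMul t1 t2 => nalg_mul A (teval v t1) (teval v t2)
  end.

(* A variety is given by a set E of identities t = 0 in the variables
   0, 1, 2, ...; this predicate says that A belongs to it. *)
Definition in_variety (R : comNzRingType) (E : set (nterm R nat))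
    (A : nalgebra R) : Prop :=
  forall t, E t -> forall v : nat -> A, teval v t = 0.

Definition is_free_algebra (R : comNzRingType) (E : set (nterm R nat)) (k : nat)
    (F : nalgebra R) (z : 'I_k -> F) : Prop :=
  in_variety E F /\
  forall B : nalgebra R, in_variety E B -> forall b : 'I_k -> B,
  exists! h : F -> B, nalg_hom h /\ forall i, h (z i) = b i.

Definition is_coproduct (R : comNzRingType) (E : set (nterm R nat))
    (A F D : nalgebra R) (inA : A -> D) (inF : F -> D) : Prop :=
  [/\ in_variety E D, nalg_hom inA, nalg_hom inF &
  forall B : nalgebra R, in_variety E B -> forall (f : A -> B) (g : F -> B),
  nalg_hom f -> nalg_hom g ->
  exists! h : D -> B, [/\ nalg_hom h, forall a, h (inA a) = f a
                        & forall u, h (inF u) = g u]].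

(* In the next definitions z i : D is the image of the i-th free generator.
   The evaluation homomorphism phi is unique whenever D is the coproduct. *)
Definition is_evaluation (R : comNzRingType) (k : nat) (A D : nalgebra R)
    (inA : A -> D) (z : 'I_k -> D) (a : 'I_k -> A) (phi : D -> A) : Prop :=
  [/\ nalg_hom phi, forall x, phi (inA x) = x & forall i, phi (z i) = a i].

Definition zero_locus (R : comNzRingType) (k : nat) (A D : nalgebra R)
    (inA : A -> D) (z : 'I_k -> D) (S : set D) : set ('I_k -> A) :=
  [set a | exists2 phi, is_evaluation inA z a phi & forall f, S f -> phi f = 0].

Definition zariski_space (R : comNzRingType) (k : nat) (A D : nalgebra R)
  (inA : A -> D) (z : 'I_k -> D) : Type := 'I_k -> A.

HB.instance Definition _ (R : comNzRingType) (k : nat) (A D : nalgebra R)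
    (inA : A -> D) (z : 'I_k -> D) :=
  Choice.copy (zariski_space inA z) ('I_k -> A).

HB.instance Definition _ (R : comNzRingType) (k : nat) (A D : nalgebra R)
    (inA : A -> D) (z : 'I_k -> D) :=
  isSubBaseTopological.Build (zariski_space inA z)
    (I := set D) setT (fun S => ~` zero_locus inA z S).

Definition noetherian_space (T : topologicalType) : Prop :=
  forall F : nat -> set T, (forall n, closed (F n)) ->
  (forall n, F n.+1 `<=` F n) -> exists N, forall n, (N <= n)%N -> F n = F N.

(* Quantified over every variety E containing A and every model F of the free
   algebra and D of the coproduct. Models always exist (free_algebra_exists,
   coproduct_exists), and the injectivity hypotheses always hold
   (coproduct_injective), so no variety containing A is left out. *)
Definition equationally_noetherian (R : comNzRingType) (A : nalgebra R) : Prop :=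
  forall E : set (nterm R nat), in_variety E A ->
  forall k : nat, (0 < k)%N ->
  forall (F : nalgebra R) (z : 'I_k -> F), is_free_algebra E z ->
  forall (D : nalgebra R) (inA : A -> D) (inF : F -> D),
  is_coproduct E inA inF -> injective inA -> injective inF ->
  noetherian_space (zariski_space inA (inF \o z)).

(* The free C_m-module on delta_0, ..., delta_{m-1}: u stands for the formal
   sum of the u i * delta_i. *)
Notation witt_module m R := {ffun 'I_m -> {mpoly R[m]}}.

Definition witt_elt (m : nat) (R : comNzRingType) (f : {mpoly R[m]})
    (i : 'I_m) : witt_module m R :=
  [ffun j => if j == i then f else 0].

Definition lsym_mul (m : nat) (R : comNzRingType) (u v : witt_module m R) :
    witt_module m R :=
  [ffun j => \sum_(i < m) u i * mderiv i (v j)].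

Lemma lsym_mul_bilinear (m : nat) (R : comNzRingType) :
  bilinear_for (@GRing.scale R (witt_module m R))
    (@GRing.scale R (witt_module m R)) (@lsym_mul m R).
Proof.
split=> [v c u1 u2|u c v1 v2]; apply/ffunP=> j;
  rewrite !ffunE scaler_sumr -big_split; apply: eq_bigr=> i _ /=.
  by rewrite !ffunE mulrDl scalerAl.
by rewrite linearP mulrDr scalerAr.
Qed.

HB.instance Definition _ (m : nat) (R : comNzRingType) :=
  bilinear_isBilinear.Build R (witt_module m R) (witt_module m R)
    (witt_module m R) *:%R *:%R (@lsym_mul m R) (@lsym_mul_bilinear m R).

Definition lsym_witt (m : nat) (R : comNzRingType) : nalgebra R :=
  NAlgebra (@lsym_mul m R).

Lemma lsym_wittE (m : nat) (R : comNzRingType) (f g : {mpoly R[m]})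
    (i j : 'I_m) :
  nalg_mul (lsym_witt m R) (witt_elt f i) (witt_elt g j)
  = witt_elt (f * mderiv i g) j.
Proof.
apply/ffunP=> l; rewrite !ffunE (bigD1 i) //= !ffunE eqxx big1 ?addr0.
  by case: eqP => // _; rewrite linear0 mulr0.
by move=> k /negbTE ki; rewrite !ffunE ki mul0r.
Qed.

Lemma witt_elt_sum (m : nat) (R : comNzRingType) (u : witt_module m R) :
  u = \sum_(i < m) witt_elt (u i) i.
Proof.
apply/ffunP=> l; rewrite sum_ffunE (bigD1 l) //= ffunE eqxx big1 ?addr0//.
by move=> i /negbTE il; rewrite ffunE eq_sym il.
Qed.

Definition nalg_commutator (R : comNzRingType) (A : nalgebra R) (u v : A) : A :=
  nalg_mul A u v - nalg_mul A v u.

Lemma nalg_commutator_bilinear (R : comNzRingType) (A : nalgebra R) :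
  bilinear_for (@GRing.scale R A) (@GRing.scale R A) (@nalg_commutator R A).
Proof.
split=> [v c u1 u2|u c v1 v2]; rewrite /nalg_commutator.
  by rewrite linearPr linearPl /= scalerBr opprD addrACA.
by rewrite linearPr linearPl /= scalerBr opprD addrACA.
Qed.

HB.instance Definition _ (R : comNzRingType) (A : nalgebra R) :=
  bilinear_isBilinear.Build R A A A *:%R *:%R
    (@nalg_commutator R A) (@nalg_commutator_bilinear R A).

Definition commutator_algebra (R : comNzRingType) (A : nalgebra R) :
  nalgebra R := NAlgebra (@nalg_commutator R A).

Definition witt (m : nat) (R : comNzRingType) : nalgebra R :=
  commutator_algebra (lsym_witt m R).

Lemma nalg_homr0 (R : comNzRingType) (A B : nalgebra R) (f : A -> B) :
  nalg_hom f -> f 0 = 0.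
Proof.
by case=> fL _; have := fL (-1) 0 0; rewrite scaler0 addr0 scaleN1r addNr.
Qed.

Lemma teval_hom (R : comNzRingType) (X : Type) (A B : nalgebra R) (f : A -> B)
    (v : X -> A) (t : nterm R X) :
  nalg_hom f -> f (teval v t) = teval (f \o v) t.
Proof.
move=> fH; have f0 := nalg_homr0 fH; case: fH => fL fM.
elim: t=> [x||s IHs t IHt|c t IHt|s IHs t IHt] //=.
- by rewrite -IHs -IHt -[in LHS](scale1r (teval v s)) fL scale1r.
- by rewrite -IHt -[in LHS](addr0 (c *: _)) fL f0 addr0.
by rewrite fM IHs IHt.
Qed.

(* The algebra presented, inside the variety E, by the generators X and the
   relations true under every assignment X -> B satisfying P.  Its elements are
   equivalence classes of terms. *)
Section Presentation.
Context (R : comNzRingType) (E : set (nterm R nat)) (X : Type).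
Context (P : forall B : nalgebra R, (X -> B) -> Prop).

Definition pres_eqv (s t : nterm R X) : Prop :=
  forall (B : nalgebra R) (h : X -> B), in_variety E B -> P h ->
  teval h s = teval h t.

Definition pres : Type := {S : set (nterm R X) | exists t, S = pres_eqv t}.

HB.instance Definition _ := gen_eqMixin pres.
HB.instance Definition _ := gen_choiceMixin pres.

Definition pres_class (t : nterm R X) : pres :=
  exist _ (pres_eqv t) (ex_intro _ t erefl).

Definition pres_repr (a : pres) : nterm R X := projT1 (cid (projT2 a)).

Lemma pres_reprK : cancel pres_repr pres_class.
Proof.
move=> a; rewrite /pres_repr; case: cid => t /=; case: a => S pS /= St.
exact: eq_exist.
Qed.

Lemma pres_classP s t : pres_class s = pres_class t <-> pres_eqv s t.
Proof.
split=> [[/(congr1 (@^~ t))] /= st|st]; first by rewrite st => B h.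
apply: eq_exist; apply/predeqP=> u; split=> ? B h EB Ph.
  by rewrite -(st B h EB Ph); auto.
by rewrite (st B h EB Ph); auto.
Qed.

Lemma pres_reprE t : pres_eqv (pres_repr (pres_class t)) t.
Proof. by apply/pres_classP; rewrite pres_reprK. Qed.

Definition pres_add (a b : pres) := pres_class (TAdd (pres_repr a) (pres_repr b)).
Definition pres_scale c (a : pres) := pres_class (TScale c (pres_repr a)).
Definition pres_mul (a b : pres) := pres_class (TMul (pres_repr a) (pres_repr b)).

Fact pres_addA : associative pres_add.
Proof.
move=> a b c; apply/pres_classP=> B h EB Ph /=.
by rewrite !pres_reprE //= addrA.
Qed.
Fact pres_addC : commutative pres_add.
Proof. by move=> a b; apply/pres_classP=> B h EB Ph /=; rewrite addrC. Qed.
Fact pres_add0 : left_id (pres_class TZero) pres_add.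
Proof.
move=> a; rewrite -[RHS]pres_reprK; apply/pres_classP=> B h EB Ph /=.
by rewrite !pres_reprE //= add0r.
Qed.
Fact pres_addN : left_inverse (pres_class TZero) (pres_scale (-1)) pres_add.
Proof.
move=> a; apply/pres_classP=> B h EB Ph /=.
by rewrite !pres_reprE //= scaleN1r addNr.
Qed.
HB.instance Definition _ :=
  GRing.isZmodule.Build pres pres_addA pres_addC pres_add0 pres_addN.

Fact pres_scaleA a b v : pres_scale a (pres_scale b v) = pres_scale (a * b) v.
Proof.
apply/pres_classP=> B h EB Ph /=; by rewrite !pres_reprE //= scalerA.
Qed.
Fact pres_scale1 : left_id 1 pres_scale.
Proof.
move=> a; rewrite -[RHS]pres_reprK; apply/pres_classP=> B h EB Ph /=.
by rewrite scale1r.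
Qed.
Fact pres_scaleDr : right_distributive pres_scale +%R.
Proof.
move=> c a b; apply/pres_classP=> B h EB Ph /=.
by rewrite !pres_reprE //= scalerDr.
Qed.
Fact pres_scaleDl v : {morph pres_scale^~ v : a b / a + b}.
Proof.
move=> a b; apply/pres_classP=> B h EB Ph /=.
by rewrite !pres_reprE //= scalerDl.
Qed.
HB.instance Definition _ := GRing.Zmodule_isLmodule.Build R pres
  pres_scaleA pres_scale1 pres_scaleDr pres_scaleDl.

Fact pres_mul_bilinear :
  bilinear_for (@GRing.scale R pres) (@GRing.scale R pres) pres_mul.
Proof.
split=> [v c u1 u2|u c v1 v2]; apply/pres_classP=> B h EB Ph /=.
  by rewrite !pres_reprE //= !pres_reprE //= linearPl.
by rewrite !pres_reprE //= !pres_reprE //= linearPr.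
Qed.
HB.instance Definition _ := bilinear_isBilinear.Build R pres pres pres
  *:%R *:%R pres_mul pres_mul_bilinear.

Definition pres_alg : nalgebra R := NAlgebra pres_mul.

Definition pres_gen (x : X) : pres_alg := pres_class (TVar x).

Definition pres_lift (B : nalgebra R) (h : X -> B) (a : pres_alg) : B :=
  teval h (pres_repr a).

Section Lift.
Context (B : nalgebra R) (h : X -> B) (EB : in_variety E B) (Ph : P h).

Lemma pres_lift_gen x : pres_lift h (pres_gen x) = h x.
Proof. exact: pres_reprE. Qed.

Lemma pres_lift_hom : nalg_hom (pres_lift h).
Proof.
split=> [c u v|u v]; rewrite /pres_lift; last exact: pres_reprE.
by rewrite pres_reprE //= pres_reprE.
Qed.
End Lift.

(* Equality in pres_alg is detected by the maps pres_lift h. *)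
Lemma pres_sep (a b : pres_alg) :
  (forall (B : nalgebra R) (h : X -> B), in_variety E B -> P h ->
     pres_lift h a = pres_lift h b) -> a = b.
Proof.
by move=> ab; rewrite -(pres_reprK a) -(pres_reprK b); apply/pres_classP.
Qed.

Lemma pres_in_variety : in_variety E pres_alg.
Proof.
move=> t Et v; apply: pres_sep=> B h EB Ph.
have lH := pres_lift_hom EB Ph.
by rewrite teval_hom // EB // nalg_homr0.
Qed.

Lemma pres_classE (t : nterm R X) : pres_class t = teval pres_gen t.
Proof.
apply: pres_sep=> B h EB Ph; have lH := pres_lift_hom EB Ph.
rewrite teval_hom // [LHS]/pres_lift pres_reprE //.
by congr teval; apply/funext=> x; rewrite /= pres_lift_gen.
Qed.

Lemma pres_lift_unique (B : nalgebra R) (f g : pres_alg -> B) :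
  nalg_hom f -> nalg_hom g -> (forall x, f (pres_gen x) = g (pres_gen x)) ->
  f = g.
Proof.
move=> fH gH fg; apply/funext=> a; rewrite -(pres_reprK a) pres_classE !teval_hom //.
by congr teval; apply/funext.
Qed.

End Presentation.

Lemma free_algebra_exists (R : comNzRingType) (E : set (nterm R nat)) (k : nat) :
  exists (F : nalgebra R) (z : 'I_k -> F), is_free_algebra E z.
Proof.
pose P (B : nalgebra R) (h : 'I_k -> B) := True.
exists (pres_alg E P), (pres_gen E P); split; first exact: pres_in_variety.
move=> B EB b; exists (pres_lift b); split.
  by split=> [|i]; [apply: pres_lift_hom|apply: pres_lift_gen].
move=> f [fH fb]; apply: pres_lift_unique => //; first exact: pres_lift_hom.
by move=> x; rewrite fb pres_lift_gen.
Qed.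

Lemma coproduct_exists (R : comNzRingType) (E : set (nterm R nat))
    (A F : nalgebra R) :
  exists (D : nalgebra R) (inA : A -> D) (inF : F -> D), is_coproduct E inA inF.
Proof.
pose P (B : nalgebra R) (h : A + F -> B) :=
  nalg_hom (h \o inl) /\ nalg_hom (h \o inr).
have inP (B : nalgebra R) (h : A + F -> B) : in_variety E B -> P B h ->
    (forall x, pres_lift h (pres_gen E P x) = h x)
    /\ nalg_hom (pres_lift (E := E) (P := P) h).
  by move=> EB Ph; split=> [x|]; [apply: pres_lift_gen|apply: pres_lift_hom].
exists (pres_alg E P), (fun a => pres_gen E P (inl a)), (fun u => pres_gen E P (inr u)).
split.
- exact: pres_in_variety.
- split=> [c u v|u v]; apply: pres_sep=> B h EB Ph;
    have [lE [lL lM]] := inP B h EB Ph; have [[hL hM] _] := Ph.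
    by rewrite lL !lE; apply: hL.
  by rewrite lM !lE; apply: hM.
- split=> [c u v|u v]; apply: pres_sep=> B h EB Ph;
    have [lE [lL lM]] := inP B h EB Ph; have [_ [hL hM]] := Ph.
    by rewrite lL !lE; apply: hL.
  by rewrite lM !lE; apply: hM.
move=> B EB f g fH gH.
pose h (x : A + F) : B := match x with inl a => f a | inr u => g u end.
have [lE lH] := inP B h EB (conj fH gH).
exists (pres_lift h); split; first by split=> // x; rewrite lE.
move=> l [lH' lA lF]; apply: pres_lift_unique => // x.
by rewrite lE; case: x => x /=; rewrite ?lA ?lF.
Qed.

Lemma nalg_hom0 (R : comNzRingType) (A B : nalgebra R) :
  nalg_hom (fun _ : A => 0 : B).
Proof.
split=> [c u v|u v]; first by rewrite scaler0 addr0.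
by rewrite linear0r.
Qed.

Lemma nalg_hom_id (R : comNzRingType) (A : nalgebra R) : nalg_hom (@id A).
Proof. by split. Qed.

(* As homomorphisms need not preserve a unit, the zero maps between A and F are
   homomorphisms, and they yield retractions of D onto A and onto F. *)
Lemma coproduct_injective (R : comNzRingType) (E : set (nterm R nat))
    (A F D : nalgebra R) (inA : A -> D) (inF : F -> D) :
  in_variety E A -> in_variety E F -> is_coproduct E inA inF ->
  injective inA /\ injective inF.
Proof.
move=> EA EF [_ _ _ univ]; split.
  have [h [[_ hA _] _]] := univ A EA _ _ (@nalg_hom_id _ _) (@nalg_hom0 _ _ _).
  exact: can_inj hA.
have [h [[_ _ hF] _]] := univ F EF _ _ (@nalg_hom0 _ _ _) (@nalg_hom_id _ _).
exact: can_inj hF.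
Qed.

Lemma zariski_openE (R : comNzRingType) (k : nat) (A D : nalgebra R)
    (inA : A -> D) (z : 'I_k -> D) (U : set (zariski_space inA z)) :
  open U <-> exists2 V, V `<=` finI_from setT (fun S => ~` zero_locus inA z S)
             & \bigcup_(W in V) W = U.
Proof. by []. Qed.

Lemma zero_locus_closed (R : comNzRingType) (k : nat) (A D : nalgebra R)
    (inA : A -> D) (z : 'I_k -> D) (S : set D) :
  closed (zero_locus inA z S : set (zariski_space inA z)).
Proof.
rewrite -[X in closed X]setCK; apply: open_closedC; apply/zariski_openE.
exists [set ~` zero_locus inA z S]; last by rewrite bigcup_set1.
by move=> _ ->; exists [fset S]%fset; rewrite ?set_fset1 ?bigcap_set1 // => x; rewrite in_setT.
Qed.

(* Main.v *)
(** A semantic form of the Ritt-Raudenbush basis theorem.  Every element of the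
    coproduct evaluates, coordinatewise, to a differential polynomial in the
    coordinates of the point, with coefficients and values in the domain
    [C = R[x_1, ..., x_m]] of characteristic 0; so it is enough that every
    ascending sequence of sets of differential polynomial functions has finally
    the same zeros.  Such functions are handled as functions on points: [f] has
    rank [(v, d)] if it is a polynomial of degree [d] in the derivative [v] whose
    coefficients involve only lower derivatives.  A set [X] of points is
    Noetherian as soon as its intersection with the zeros of every [f] that is
    not identically zero on [X] is.  Let [G] be a list of ranks of functions
    which vanish on [X] while their initials and separants have no zero on [X].
    If the rank of [f] is reducible by [G], pseudo-division lowers it without
    changing the zeros of [f] on [X]; otherwise the zeros of [f] split into those
    of its initial, those of its separant (both of lower rank), and the rest, on
    which [G] can be extended by the rank of [f].  Dickson's lemma bounds the
    extensions of [G]. *)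

Require Import Defs.
From mathcomp Require Import all_boot all_order all_algebra.
From mathcomp Require Import boolp classical_sets topology mpoly.
From mathcomp Require Import finmap ring.

Set Implicit Arguments.
Unset Strict Implicit.
Unset Printing Implicit Defensive.

Import Order.TTheory GRing.Theory.
Local Open Scope classical_set_scope.
Local Open Scope ring_scope.

(** * Bar induction over bad sequences *)

(** If [P] failed at the empty list, dependent choice would prolong lists violating [P] forever;
    their successive heads, newest first in each list, form a sequence [u] in which no earlier term
    is [R]-related to a later one. *)
Lemma wqo_bar_ind (T : eqType) (R : T -> T -> Prop) (P : seq T -> Prop) :
    (forall u : nat -> T, exists i j, (i < j)%N /\ R (u i) (u j)) ->
    (forall s, (forall x, (forall y, y \in s -> ~ R y x) -> P (x :: s)) ->
      P s) ->
  P [::].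
Proof.
move=> wqoR stepP; apply: contrapT => nP0.
have next (s : {s | ~ P s}) :
    {t : {s | ~ P s} | exists2 x, sval t = x :: sval s
                     & forall y, y \in sval s -> ~ R y x}.
  apply: cid; case: s => s /= nPs.
  have [x] : exists x, ~ ((forall y, y \in s -> ~ R y x) -> P (x :: s)).
    by apply/not_existsP => H; apply: nPs; apply: stepP => x; apply: contrapT.
  by move=> /not_implyP[bad nPx]; exists (exist _ (x :: s) nPx); exists x.
have [f [_ fS]] := dependent_choice next (exist _ [::] nP0).
have [u uP] := choice (fun n => let: ex_intro2 x e b := fS n in
  ex_intro (fun x => sval (f n.+1) = x :: sval (f n) /\
     forall y, y \in sval (f n) -> ~ R y x) x (conj e b)).
have [i [j [ij]]] := wqoR u.
have uf k : u i \in sval (f (i.+1 + k)%N).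
  elim: k => [|k IH]; first by rewrite addn0 (uP i).1 mem_head.
  by rewrite addnS (uP _).1 inE IH orbT.
by apply: (uP j).2; rewrite -(subnKC ij).
Qed.

(** * Differential polynomial functions over a domain *)

Section RittRaudenbush.
Context (C : idomainType) (charC : forall n, n.+1%:R != 0 :> C).
Context (L Pt : Type) (disp : Order.disp_t) (V : orderType disp).
Context (V_wf : well_founded (fun v w : V => (v < w)%O)).
Context (der : L -> C -> C) (var : V -> Pt -> C) (sh : L -> V -> V).
Context (derD : forall l, {morph der l : x y / x + y}).
Context (derM : forall l x y, der l (x * y) = der l x * y + x * der l y).
Context (der_var : forall l v a, der l (var v a) = var (sh l v) a).
Context (lt_sh : forall l v, (v < sh l v)%O).
Context (sh_lt : forall l, {homo sh l : v w / (v < w)%O}).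

(** The set [U] limits the derivatives used in some expression of the function; this replaces the
    notion of a derivative occurring in a formal polynomial. *)
Inductive dpol (U : set V) : (Pt -> C) -> Prop :=
| dpol_cst c : dpol U (fun=> c)
| dpol_var v : U v -> dpol U (var v)
| dpolD f g : dpol U f -> dpol U g -> dpol U (fun a => f a + g a)
| dpolM f g : dpol U f -> dpol U g -> dpol U (fun a => f a * g a).

Lemma dpolS U U' f : U `<=` U' -> dpol U f -> dpol U' f.
Proof.
move=> UU'; elim=> [c|v /UU'|g h _ + _|g h _ + _];
  [exact: dpol_cst|exact: dpol_var|exact: dpolD|exact: dpolM].
Qed.

Lemma dpolN U f : dpol U f -> dpol U (fun a => - f a).
Proof.
move=> /(dpolM (dpol_cst U (-1))); congr dpol.
by apply/funext => a; rewrite mulN1r.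
Qed.

Lemma dpolX U f n : dpol U f -> dpol U (fun a => f a ^+ n).
Proof.
move=> Uf; elim: n => [|n IH]; first exact: (dpol_cst U 1).
have -> : (fun a => f a ^+ n.+1) = (fun a => f a * f a ^+ n).
  by apply/funext => a; rewrite exprS.
exact: dpolM.
Qed.

Lemma dpol_sum U (I : Type) (r : seq I) (F : I -> Pt -> C) :
  (forall i, dpol U (F i)) -> dpol U (fun a => \sum_(i <- r) F i a).
Proof.
move=> UF; elim: r => [|i r IH].
  have -> : (fun a => \sum_(i <- [::]) F i a) = fun=> 0.
    by apply/funext => a; rewrite big_nil.
  exact: dpol_cst.
have -> : (fun a => \sum_(j <- i :: r) F j a)
    = fun a => F i a + \sum_(j <- r) F j a.
  by apply/funext => a; rewrite big_cons.
exact: dpolD.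
Qed.

Lemma dpol_der U U' l f :
    U `<=` U' -> (forall v, U v -> U' (sh l v)) -> dpol U f ->
  dpol U' (fun a => der l (f a)).
Proof.
move=> UU' Ush; elim=> [c|v Uv|g h Ug IHg Uh IHh|g h Ug IHg Uh IHh].
- exact: (dpol_cst _ (der l c)).
- have -> : (fun a => der l (var v a)) = var (sh l v).
    by apply/funext => a; rewrite der_var.
  by apply: dpol_var; apply: Ush.
- have -> : (fun a => der l (g a + h a))
      = fun a => der l (g a) + der l (h a).
    by apply/funext => a; rewrite derD.
  exact: dpolD.
have -> : (fun a => der l (g a * h a))
    = fun a => der l (g a) * h a + g a * der l (h a).
  by apply/funext => a; rewrite derM.
by apply: dpolD; apply: dpolM => //; apply: dpolS UU' _.
Qed.

(** * Leaders, and polynomials in the leader *)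

Definition below (v : V) : set V := [set u | (u < v)%O].
Definition upto (v : V) : set V := [set u | (u <= v)%O].

Lemma belowS v w : (v <= w)%O -> below v `<=` below w.
Proof. by move=> vw u /lt_le_trans; apply. Qed.

Lemma uptoS v w : (v <= w)%O -> upto v `<=` upto w.
Proof. by move=> vw u /le_trans; apply. Qed.

(** The derivative [v] is only an upper bound: for a sum or a product, both treated by [mrg], the
    larger of the two bounds is taken, whether or not terms cancel. *)
Lemma dpol_leader U f : dpol U f ->
  (exists c, f = fun=> c) \/ (exists2 v, U v & dpol (upto v) f).
Proof.
have mrg (op : (Pt -> C) -> (Pt -> C) -> Pt -> C) g h :
    (forall U g h, dpol U g -> dpol U h -> dpol U (op g h)) ->
    (forall c c', exists c'', op (fun=> c) (fun=> c') = fun=> c'') ->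
    (exists c, g = fun=> c) \/ (exists2 v, U v & dpol (upto v) g) ->
    (exists c, h = fun=> c) \/ (exists2 v, U v & dpol (upto v) h) ->
    (exists c, op g h = fun=> c) \/ (exists2 v, U v & dpol (upto v) (op g h)).
  move=> opP opc [[c ->]|[v Uv vg]] [[c' ->]|[w Uw wh]].
  - by left; apply: opc.
  - by right; exists w => //; apply: opP => //; apply: dpol_cst.
  - by right; exists v => //; apply: opP => //; apply: dpol_cst.
  right; have [vw|/ltW wv] := leP v w.
    by exists w => //; apply: opP => //; apply: dpolS vg; apply: uptoS.
  by exists v => //; apply: opP => //; apply: dpolS wh; apply: uptoS.
elim=> [c|v Uv|g h _ IHg _ IHh|g h _ IHg _ IHh].
- by left; exists c.
- by right; exists v => //; apply: dpol_var; rewrite /upto /=.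
- apply: (mrg (fun g h a => g a + h a)) => // [U' g' h'|c c'].
    exact: dpolD.
  by exists (c + c').
apply: (mrg (fun g h a => g a * h a)) => // [U' g' h'|c c'].
  exact: dpolM.
by exists (c * c').
Qed.

(** The degree of [p a] may vary with the point [a], so a uniform bound on the size is always
    carried along separately. *)
Definition coef_below (v : V) (p : Pt -> {poly C}) : Prop :=
  forall i, dpol (below v) (fun a => (p a)`_i).

Lemma coef_belowD v p q : coef_below v p -> coef_below v q ->
  coef_below v (fun a => p a + q a).
Proof.
move=> vp vq i.
have -> : (fun a => (p a + q a)`_i) = fun a => (p a)`_i + (q a)`_i.
  by apply/funext => a; rewrite coefD.
exact: dpolD.
Qed.

Lemma coef_belowM v p q : coef_below v p -> coef_below v q ->
  coef_below v (fun a => p a * q a).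
Proof.
move=> vp vq i.
have -> : (fun a => (p a * q a)`_i)
    = fun a => \sum_(j < i.+1) (p a)`_j * (q a)`_(i - j).
  by apply/funext => a; rewrite coefM.
by apply: dpol_sum => j; apply: dpolM.
Qed.

Lemma coef_below_polyC v f : dpol (below v) f ->
  coef_below v (fun a => (f a)%:P).
Proof.
move=> vf [|i]; last first.
  have -> : (fun a => (f a)%:P`_i.+1) = fun=> 0.
    by apply/funext => a; rewrite coefC.
  exact: dpol_cst.
by have -> : (fun a => (f a)%:P`_0) = f by apply/funext => a; rewrite coefC.
Qed.

Lemma coef_below_cst v p : coef_below v (fun=> p).
Proof. by move=> i; apply: dpol_cst. Qed.

Lemma coef_belowN v p : coef_below v p -> coef_below v (fun a => - p a).
Proof.
move=> vp i; have -> : (fun a => (- p a)`_i) = fun a => - (p a)`_i.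
  by apply/funext => a; rewrite coefN.
exact: dpolN.
Qed.

Lemma coef_below_deriv v p : coef_below v p ->
  coef_below v (fun a => (p a)^`()).
Proof.
move=> vp i.
have -> : (fun a => (p a)^`()`_i) = fun a => (p a)`_i.+1 * i.+1%:R.
  by apply/funext => a; rewrite coef_deriv mulr_natr.
by apply: dpolM => //; apply: dpol_cst.
Qed.

Lemma dpol_horner v p f d : coef_below v p -> (forall a, (size (p a) <= d)%N) ->
  forall U, below v `<=` U -> dpol U f -> dpol U (fun a => (p a).[f a]).
Proof.
move=> vp pd U vU Uf.
have -> : (fun a => (p a).[f a])
    = fun a => \sum_(i < d) (p a)`_i * f a ^+ i.
  by apply/funext => a; rewrite (horner_coef_wide _ (pd a)).
by apply: dpol_sum => i; apply: dpolM; [apply: dpolS (vp i)|apply: dpolX].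
Qed.

Lemma dpol_upto_poly v f : dpol (upto v) f ->
  exists p d, [/\ coef_below v p, forall a, (size (p a) <= d)%N
    & f = fun a => (p a).[var v a]].
Proof.
elim=> [c|w|g h _ [p [d [vp pd ->]]] _ [q [e [vq qe ->]]]
       |g h _ [p [d [vp pd ->]]] _ [q [e [vq qe ->]]]].
- exists (fun=> c%:P), 1%N; split=> [|a|]; first exact: coef_below_cst.
    exact: size_polyC_leq1.
  by apply/funext => a; rewrite hornerC.
- rewrite /upto /= le_eqVlt => /orP[/eqP ->|wv].
    exists (fun=> 'X), 2%N; split=> [|a|]; first exact: coef_below_cst.
      by rewrite size_polyX.
    by apply/funext => a; rewrite hornerX.
  exists (fun a => (var w a)%:P), 1%N; split=> [|a|].
  + by apply: coef_below_polyC; apply: dpol_var.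
  + exact: size_polyC_leq1.
  + by apply/funext => a; rewrite hornerC.
- exists (fun a => p a + q a), (maxn d e); split=> [|a|].
  + exact: coef_belowD.
  + rewrite (leq_trans (size_polyD _ _)) // geq_max !leq_max pd qe.
    by rewrite orbT.
  + by apply/funext => a; rewrite hornerD.
exists (fun a => p a * q a), (d + e)%N; split=> [|a|].
- exact: coef_belowM.
- rewrite (leq_trans (size_polyMleq _ _)) // (leq_trans (leq_pred _)) //.
  by rewrite leq_add.
- by apply/funext => a; rewrite hornerM.
Qed.

(** * Noetherian sets of points *)

(** Semantic counterpart of the ascending chain condition on radical differential ideals: only the
    zeros in [X] have to become stationary. *)
Definition noeth (X : set Pt) : Prop :=
  forall F : nat -> set (Pt -> C), (forall n, F n `<=` dpol setT) ->
  (forall i j, (i <= j)%N -> F i `<=` F j) ->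
  exists N, forall a, X a -> (forall f, F N f -> f a = 0) ->
    forall n f, F n f -> f a = 0.

Lemma noeth_sub X Y : X `<=` Y -> noeth Y -> noeth X.
Proof.
by move=> XY nY F Fd Fm; have [N FN] := nY F Fd Fm; exists N => a /XY /FN.
Qed.

Lemma noethU X Y : noeth X -> noeth Y -> noeth (X `|` Y).
Proof.
move=> nX nY F Fd Fm.
have [N FN] := nX F Fd Fm; have [M FM] := nY F Fd Fm.
exists (maxn N M) => a XYa a0; case: XYa => [/FN|/FM]; apply=> f Ff;
  by apply: a0; apply: Fm Ff; rewrite leq_max leqnn ?orbT.
Qed.

Definition zeros (f : Pt -> C) : set Pt := [set a | f a = 0].

(** Either all functions of the sequence vanish on [X], and stage 0 serves, or some [f] of a stage
    [n] does not; from [n] on the common zeros in [X] lie in [zeros f]. *)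
Lemma noeth_split X :
    (forall f, dpol setT f -> (exists2 a, X a & f a != 0) ->
      noeth (X `&` zeros f)) ->
  noeth X.
Proof.
move=> H F Fd Fm.
have [[n [f [Ff Xf]]]|nF] :=
  pselect (exists n f, F n f /\ exists2 a, X a & f a != 0).
  have [N FN] := H f (Fd _ _ Ff) Xf F Fd Fm.
  exists (maxn n N) => a Xa a0; apply: FN.
    by split=> //; apply: a0; apply: Fm Ff; rewrite leq_maxl.
  by move=> g Fg; apply: a0; apply: Fm Fg; rewrite leq_maxr.
exists 0%N => a Xa _ n f Ff; apply/eqP; apply: contraPT Ff => fa Ff.
by apply: nF; exists n, f; split=> //; exists a.
Qed.

(* On X the element of rank r is zero while its initial and separant do not
   vanish. *)
Definition solved (X : set Pt) (r : V * nat) : Prop :=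
  exists p, [/\ coef_below r.1 p, forall a, (size (p a) <= r.2.+1)%N &
    forall a, X a -> [/\ (p a).[var r.1 a] = 0, (p a)`_r.2 != 0
                       & (p a)^`().[var r.1 a] != 0]].

Lemma solvedS X Y r : X `<=` Y -> solved Y r -> solved X r.
Proof. by move=> XY [p [? ? Yp]]; exists p; split=> // a /XY /Yp. Qed.

(** * Linear relations for proper derivatives *)

(** On [X] the value of [var v] is $-w/s$ in the fraction field, so [v] can be eliminated by
    clearing denominators. *)
Definition linear_rel (X : set Pt) (v : V) : Prop :=
  exists s w, [/\ dpol (below v) s, dpol (below v) w &
    forall a, X a -> s a * var v a + w a = 0 /\ s a != 0].

(** Differentiating $s v + w = 0$ keeps [s] as the leading coefficient; the other terms stay below
    [sh l v] because [sh l] is increasing and raises [v]. *)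
Lemma linear_rel_sh X v l : linear_rel X v -> linear_rel X (sh l v).
Proof.
move=> [s [w [vs vw Xsw]]].
have vsh : below v `<=` below (sh l v) by apply: belowS; apply/ltW.
exists s, (fun a => der l (s a) * var v a + der l (w a)); split.
- exact: dpolS vs.
- apply: dpolD; first apply: dpolM.
  + by apply: dpol_der vs => // u; apply: sh_lt.
  + by apply: dpol_var; apply: lt_sh.
  + by apply: dpol_der vw => // u; apply: sh_lt.
move=> a Xa; have [sw s0] := Xsw a Xa; split=> //.
have der0 : der l 0 = 0 by apply: (addrI (der l 0)); rewrite -derD !addr0.
by rewrite -der_var addrA [s a * _ + _]addrC -derM -derD sw.
Qed.

Definition der_poly l (p : {poly C}) : {poly C} :=
  \poly_(i < size p) der l p`_i.

Lemma der0 l : der l 0 = 0.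
Proof. by apply: (addrI (der l 0)); rewrite -derD !addr0. Qed.

Lemma coef_der_poly l p i : (der_poly l p)`_i = der l p`_i.
Proof.
by rewrite coef_poly; case: ltnP => // pi; rewrite nth_default ?der0.
Qed.

Lemma der_horner l (p : {poly C}) x :
  der l p.[x] = (der_poly l p).[x] + p^`().[x] * der l x.
Proof.
elim/poly_ind: p => [|p c IH].
  rewrite /der_poly size_poly0 poly_def big_ord0 linear0 !horner0 der0.
  by rewrite mul0r addr0.
have -> : der_poly l (p * 'X + c%:P) = der_poly l p * 'X + (der l c)%:P.
  apply/polyP => i; rewrite coef_der_poly !coefD !coefMX !coefC coef_der_poly.
  by case: i => [|i] /=; rewrite ?add0r ?addr0.
rewrite derivD derivM derivX derivC !hornerE derD derM IH; ring.
Qed.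

Lemma size_deriv_leq (p : {poly C}) d : (size p <= d)%N ->
  (size p^`() <= d.-1)%N.
Proof.
have [->|p0] := eqVneq p 0; first by rewrite linear0 size_poly0.
move=> pd; have := leq_trans (lt_size_deriv p0) pd.
by case: d {pd}.
Qed.

(** By the chain rule [der_horner], differentiating the equation of [v] gives one that is linear in
    [sh l v], with the separant as its leading coefficient. *)
Lemma solved_linear_rel X r l : solved X r -> linear_rel X (sh l r.1).
Proof.
case: r => v e [p /= [vp pe Xp]].
have vsh : below v `<=` below (sh l v) by apply: belowS; apply/ltW.
have vu : dpol (below (sh l v)) (var v) by apply: dpol_var; apply: lt_sh.
exists (fun a => (p a)^`().[var v a]),
  (fun a => (der_poly l (p a)).[var v a]); split.
- apply: (dpol_horner (coef_below_deriv vp) (d := e)) => // a.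
  exact: size_deriv_leq (pe a).
- apply: (@dpol_horner (sh l v) _ _ e.+1) => // [i|a].
    have -> : (fun a => (der_poly l (p a))`_i) = fun a => der l (p a)`_i.
      by apply/funext => a; rewrite coef_der_poly.
    by apply: dpol_der (vp i) => // u; apply: sh_lt.
  exact: leq_trans (size_poly _ _) (pe a).
move=> a Xa; have [p0 _ s0] := Xp a Xa; split=> //.
by rewrite addrC -der_var -der_horner p0 der0.
Qed.

Definition reach v w := exists ls, w = foldr sh v ls.

(** The derivation that leaves [r.1] gives a linear relation through the separant; every further one
    preserves it. *)
Lemma reach_linear_rel X r v : solved X r -> reach r.1 v -> v != r.1 ->
  linear_rel X v.
Proof.
move=> Xr [ls ->{v}]; elim: ls => [|l ls IH] /=; first by rewrite eqxx.
have [-> _|/IH Xls _] := eqVneq (foldr sh r.1 ls) r.1.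
  exact: solved_linear_rel.
exact: linear_rel_sh.
Qed.

(** * Reduction and induction on ranks *)

(** Comparing degrees is what pseudo-division asks for when the derivatives coincide; together the
    two conditions form a product order, to which Dickson's lemma applies. *)
Definition reducible (r r' : V * nat) := reach r.1 r'.1 /\ (r.2 <= r'.2)%N.

Section Step.
Context (G : seq (V * nat)).
Context (IHG : forall r, (forall g, g \in G -> ~ reducible g r) ->
  forall X, (forall g, g \in r :: G -> solved X g) -> noeth X).

(** Here [d] bounds the size, so the degree is less than [d], whereas the ranks in [G] record the
    degree itself. *)
Definition noeth_rank v d := forall X p,
  (forall g, g \in G -> solved X g) -> coef_below v p ->
  (forall a, (size (p a) <= d)%N) ->
  (exists2 a, X a & (p a).[var v a] != 0) ->
  noeth (X `&` zeros (fun a => (p a).[var v a])).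

Lemma noeth_const X c : c != 0 -> noeth (X `&` zeros (fun=> c)).
Proof.
move=> /eqP c0; apply: noeth_split => f _ [a [_ ac]]; by case: c0.
Qed.

Lemma noeth_below v X f : (forall w d, (w < v)%O -> noeth_rank w d) ->
  (forall g, g \in G -> solved X g) -> dpol (below v) f ->
  (exists2 a, X a & f a != 0) -> noeth (X `&` zeros f).
Proof.
move=> IH XG /dpol_leader[[c ->] [a _ c0]|[w wv /dpol_upto_poly]].
  exact: noeth_const.
by move=> [p [d [wp pd ->]]]; apply: (IH w d wv).
Qed.

Lemma size_sub_lead (p q : {poly C}) d : (size p <= d.+1)%N ->
  (size q <= d.+1)%N -> p`_d = q`_d -> (size (p - q)%R <= d)%N.
Proof.
move=> pd qd pq; apply/leq_sizeP => j; rewrite leq_eqVlt coefB.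
case/orP => [/eqP <-|dj]; first by rewrite pq subrr.
by rewrite (leq_sizeP _ _ pd) // (leq_sizeP _ _ qd) // subr0.
Qed.

(** Well-founded induction on [v], then induction on [d]. Apart from size 0, which is contradictory,
    the zeros are enclosed in sets that are Noetherian by a lower [v], a smaller [d] or a longer
    [G]. *)
Lemma noeth_zeros v d : noeth_rank v d.
Proof.
elim/(well_founded_ind V_wf): v d => v IHv d.
elim: d => [|d IHd] X p XG vp pd [a0 Xa0 pa0].
  by move: (pd a0) pa0; rewrite leqn0 size_poly_eq0 => /eqP ->;
     rewrite horner0 eqxx.
have nbelow Y f := noeth_below (f := f) (X := Y) (fun w d wv => IHv w wv d).
case: d IHd pd => [_|d IHd] pd.
  have pE a : (p a).[var v a] = (p a)`_0.
    by rewrite {1}(size1_polyC (pd a)) hornerC.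
  have -> : (fun a => (p a).[var v a]) = fun a => (p a)`_0.
    by apply/funext => a; rewrite pE.
  by apply: nbelow => //; exists a0; rewrite // -pE.
(* The size bound is now [d.+2], so the rank to compare with [G] has degree [d.+1]. *)
have [[[w e] Gg [/= wv ed]]|nG] :=
  pselect (exists2 g, g \in G & reducible g (v, d.+1)).
  have [vw|vw] := eqVneq v w.
    have [q [/= vq qe Xq]] := XG _ Gg; rewrite -{w}vw in Gg wv vq Xq.
    (* One step of pseudo-division: the terms of degree [d.+1] cancel, and since [q] vanishes at [v]
       the value is only multiplied by the nonzero initial of [q]. *)
    pose p' a := ((q a)`_e)%:P * p a - ((p a)`_d.+1)%:P * 'X^(d.+1 - e) * q a.
    have p'E a : X a -> (p' a).[var v a] = (q a)`_e * (p a).[var v a].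
      by move=> /Xq[q0 _ _]; rewrite /p' !hornerE q0 mulr0 subr0.
    apply: (@noeth_sub _ (X `&` zeros (fun a => (p' a).[var v a]))).
      by move=> a [Xa za]; split=> //; rewrite /zeros /= p'E // za mulr0.
    apply: IHd => // [|a|].
    + apply: coef_belowD.
        by apply: coef_belowM => //; apply: coef_below_polyC.
      apply: coef_belowN; apply: coef_belowM => //; apply: coef_belowM.
        exact: coef_below_polyC.
      exact: coef_below_cst.
    + apply: size_sub_lead.
      * rewrite mul_polyC; exact: leq_trans (size_scale_leq _ _) (pd a).
      * rewrite -mulrA mul_polyC (leq_trans (size_scale_leq _ _)) //.
        rewrite (leq_trans (size_polyMleq _ _)) // size_polyXn addSn /=.
        by rewrite (leq_trans (leq_add (leqnn _) (qe a))) // addnS subnK.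
      * rewrite -mulrA !mul_polyC !coefZ coefXnM ltnNge leq_subr /=.
        by rewrite subKn // mulrC.
    + exists a0 => //; rewrite p'E // mulf_neq0 //.
      by have [] := Xq _ Xa0.
  have [s [u [vs vu Xsu]]] := reach_linear_rel (XG _ Gg) wv vw.
  (* This is $s^{d+1} p(v)$ with each $s v$ replaced by $-u$, hence free of [v]. *)
  pose f a := \sum_(i < d.+2) (p a)`_i * s a ^+ (d.+1 - i) * (- u a) ^+ i.
  have fE a : X a -> f a = s a ^+ d.+1 * (p a).[var v a].
    move=> /Xsu[/eqP]; rewrite addr_eq0 => /eqP su _.
    rewrite (horner_coef_wide _ (pd a)) mulr_sumr; apply: eq_bigr => i _.
    have -> : s a ^+ d.+1 = s a ^+ (d.+1 - i) * s a ^+ i.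
      by rewrite -exprD subnK // -ltnS.
    rewrite -su exprMn; ring.
  apply: (@noeth_sub _ (X `&` zeros f)).
    by move=> a [Xa za]; split=> //; rewrite /zeros /= fE // za mulr0.
  apply: nbelow => //.
    apply: dpol_sum => i; apply: dpolM; first apply: dpolM => //.
      exact: dpolX.
    by apply: dpolX; apply: dpolN.
  exists a0 => //; rewrite fE // mulf_neq0 // expf_neq0 //.
  by have [] := Xsu _ Xa0.
have [I0|nI0] := pselect (forall a, X a -> (p a)`_d.+1 = 0).
  pose p' a := p a - ((p a)`_d.+1)%:P * 'X^(d.+1).
  have p'E a : X a -> (p' a).[var v a] = (p a).[var v a].
    by move=> /I0 pd0; rewrite /p' pd0 polyC0 mul0r subr0.
  apply: (@noeth_sub _ (X `&` zeros (fun a => (p' a).[var v a]))).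
    by move=> a [Xa za]; split=> //; rewrite /zeros /= p'E.
  apply: IHd => // [|a|].
  - apply: coef_belowD => //; apply: coef_belowN; apply: coef_belowM.
      exact: coef_below_polyC.
    exact: coef_below_cst.
  - apply: size_sub_lead => //.
      by rewrite mul_polyC (leq_trans (size_scale_leq _ _)) ?size_polyXn.
    by rewrite mul_polyC coefZ coefXn eqxx mulr1.
  - by exists a0; rewrite // p'E.
have [s0|ns0] := pselect (forall a, X a -> (p a)^`().[var v a] = 0).
  (* As in Euler's identity the terms of degree [d.+1] cancel. The separant being zero on [X], the
     value is [d.+1] times that of [p], still nonzero at [a0] in characteristic 0. *)
  pose p' a := (d.+1%:R)%:P * p a - 'X * (p a)^`().
  have p'E a : X a -> (p' a).[var v a] = d.+1%:R * (p a).[var v a].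
    move=> /s0 pd0; rewrite /p' hornerD hornerN !hornerM pd0 mulr0 subr0.
    by rewrite hornerC.
  apply: (@noeth_sub _ (X `&` zeros (fun a => (p' a).[var v a]))).
    by move=> a [Xa za]; split=> //; rewrite /zeros /= p'E // za mulr0.
  apply: IHd => // [|a|].
  - apply: coef_belowD.
      by apply: coef_belowM => //; apply: coef_below_cst.
    apply: coef_belowN; apply: coef_belowM; first exact: coef_below_cst.
    exact: coef_below_deriv.
  - apply: size_sub_lead.
    + rewrite mul_polyC; exact: leq_trans (size_scale_leq _ _) (pd a).
    + rewrite (leq_trans (size_polyMleq _ _)) // size_polyX /=.
      exact: size_deriv_leq (pd a).
    + by rewrite mul_polyC coefZ coefXM /= coef_deriv mulr_natl.
  - by exists a0; rewrite // p'E // mulf_neq0.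
(* On [Y] the polynomial [p] itself witnesses that [(v, d.+1)] is solved, so [IHG] applies. *)
pose Y := X `&` zeros (fun a => (p a).[var v a])
  `&` [set a | (p a)`_d.+1 != 0 /\ (p a)^`().[var v a] != 0].
apply: (@noeth_sub _ (X `&` zeros (fun a => (p a)`_d.+1)
    `|` (X `&` zeros (fun a => (p a)^`().[var v a])) `|` Y)).
  move=> a [Xa za]; have [?|I0] := eqVneq ((p a)`_d.+1) 0; first by left; left.
  have [?|t0] := eqVneq ((p a)^`().[var v a]) 0; first by left; right.
  by right.
apply: noethU; first apply: noethU.
- apply: nbelow => //; apply: contrapT => n0; apply: nI0 => a Xa.
  by apply: contrapT => /eqP ?; apply: n0; exists a.
- apply: IHd => // [|a|].
  + exact: coef_below_deriv.
  + exact: size_deriv_leq (pd a).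
  + apply: contrapT => n0; apply: ns0 => a Xa.
    by apply: contrapT => /eqP ?; apply: n0; exists a.
apply: (IHG (r := (v, d.+1))) => [g Gg gr|g].
  by apply: nG; exists g.
rewrite inE => /orP[/eqP ->|/XG Xg]; last first.
  by apply: solvedS Xg => a [[]].
by exists p; split=> // a [[Xa za] [? ?]].
Qed.

End Step.

Context (dickson : forall u : nat -> V * nat,
  exists i j, (i < j)%N /\ reducible (u i) (u j)).

Theorem noethT : noeth setT.
Proof.
pose P (G : seq (V * nat)) :=
  forall X, (forall g, g \in G -> solved X g) -> noeth X.
suff : P [::] by apply.
apply: (wqo_bar_ind dickson) => G IHG X XG.
apply: noeth_split => f /dpol_leader[[c ->] [a _ c0]|[v _ /dpol_upto_poly]].
  exact: noeth_const.
move=> [p [d [vp pd ->]]] Xp; exact: (noeth_zeros IHG).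
Qed.

End RittRaudenbush.

(** * The ring of polynomials with its partial derivatives *)

(** After a subsequence [s] is found for all functions but the first, it is thinned out once more
    for that one. *)
Lemma dickson_seq (k : nat) (f : 'I_k -> nat -> nat) :
  exists2 s : nat -> nat, {homo s : i j / (i < j)%N} &
    forall l, {homo f l \o s : i j / (i <= j)%N}.
Proof.
elim: k f => [|k IH] f; first by exists id => // -[].
have [s sM fs] := IH (fun l => f (lift ord0 l)).
have next n : {j | (n <= j)%N /\
    forall i, (n <= i)%N -> (f ord0 (s j) <= f ord0 (s i))%N}.
  apply: cid; pose Q v := `[< exists2 j, (n <= j)%N & f ord0 (s j) = v >].
  have exQ : exists v, Q v by exists (f ord0 (s n)); apply/asboolP; exists n.
  case: (ex_minnP exQ) => v /asboolP[j nj fj] vmin; exists j; split=> // i ni.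
  by rewrite fj; apply: vmin; apply/asboolP; exists i.
(* Each chosen index minimizes [f ord0 \o s] over all indices still available, so later choices
   cannot give smaller values. *)
pose fix t n := sval (next (if n is n'.+1 then (t n').+1 else 0%N)).
have tM : {homo t : i j / (i < j)%N}.
  apply: homo_ltn; first exact: ltn_trans.
  by move=> i /=; have [] := svalP (next (t i).+1).
have t0 i : exists2 n, t i = sval (next n)
    & forall j, (i < j)%N -> (n <= t j)%N.
  case: i => [|i] /=; [exists 0%N|exists (t i).+1] => // j ij.
  by apply: tM; apply: ltnW.
exists (s \o t) => [i j /tM /sM //|l i j].
rewrite leq_eqVlt => /orP[/eqP -> //|ij] /=.
case: (unliftP ord0 l) => [l' ->|->]; first by apply: fs; apply/ltnW/tM.
have [n -> nj] := t0 i; have [_] := svalP (next n); apply; exact: nj.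
Qed.

Definition eval_val (R : comNzRingType) (k : nat) (A : nalgebra R)
    (a : 'I_k -> A) (x : A + 'I_k) : A :=
  match x with inl x => x | inr i => a i end.

Section Instance.
Context (R : idomainType) (m k : nat).
Context (charR : forall n, n.+1%:R != 0 :> R).
Notation W := (witt_module m R).
Notation C := {mpoly R[m]}.
Notation N := #|{: 'I_k * 'I_m}|.
Notation V := ('X_{1..m} *l 'I_N)%type.

(** The second component of [v] encodes a pair of an unknown and one of its coordinates; numbering
    the pairs makes the derivatives totally ordered, multi-index first. *)
Definition witt_var (v : V) (a : 'I_k -> W) : C :=
  mderivm v.1 (a (enum_val v.2).1 (enum_val v.2).2).

Definition witt_shift (l : 'I_m) (v : V) : V := ((v.1 + U_(l))%MM, v.2).

Lemma witt_index_wf : well_founded (fun v w : V => (v < w)%O).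
Proof.
case=> mu i; elim/(@ltmwf m): mu i => mu IHmu [i iN].
elim/ltn_ind: i iN => i IHi iN; constructor=> -[nu [j jN]].
rewrite ltxi_pair => /andP[]; rewrite le_eqVlt => /orP[/eqP ->|numu _].
  by rewrite lexx /= => ji; apply: IHi.
exact: IHmu.
Qed.

Lemma witt_shift_reach (nu mu : 'X_{1..m}) (i : 'I_N) :
  reach witt_shift (mu, i) ((mu + nu)%MM, i).
Proof.
elim: {nu}_.+1 {-2}nu (ltnSn (mdeg nu)) => // d IH nu nud.
have [nu0|] := eqVneq (mdeg nu) 0%N.
  by move/eqP: nu0; rewrite mdeg_eq0 => /eqP ->; exists [::]; rewrite addm0.
rewrite mdeg_eq0 => nu0.
have [l nul] : exists l, nu l != 0%N.
  apply/existsP; apply: contraNT nu0 => /existsPn H; apply/eqP/mnmP => l.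
  by rewrite mnm0E; apply/eqP; move: (H l); rewrite negbK.
have Unu : (U_(l) <= nu)%MM by rewrite lep1mP.
have [|ls E] := IH (nu - U_(l))%MM.
  by move: nud; rewrite -{1}(submK Unu) mdegD mdeg1 addn1 ltnS.
exists (l :: ls); rewrite /= -E /witt_shift /=.
by rewrite -addmA submK.
Qed.

Lemma witt_dickson (u : nat -> V * nat) :
  exists i j, (i < j)%N /\ reducible witt_shift (u i) (u j).
Proof.
(* The index [i] is constant along a subsequence on which both [i] and [N - i]
   are nondecreasing. *)
have [s sM us] := dickson_seq (fun (l : 'I_(m + 3)) n =>
  match split l with
  | inl l => (u n).1.1 l
  | inr l => nth 0%N [:: (u n).1.2 : nat; (N - (u n).1.2)%N; (u n).2] l
  end).
exists (s 0%N), (s 1%N); split; first exact: sM.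
have us3 (l : 'I_3) := us (unsplit (inr l)) 0%N 1%N isT.
have us0 (l : 'I_m) := us (unsplit (inl l)) 0%N 1%N isT.
move: us3 us0; rewrite /= => us3 us0.
have H0 := us3 (inord 0); have H1 := us3 (inord 1); have H2 := us3 (inord 2).
move: H0 H1 H2; rewrite !(unsplitK (inr _)) !inordK //= => H0 H1 H2.
split=> //; move: H0 H1 us0.
case: (u (s 0%N)) (u (s 1%N)) => [[mu i] d] [[nu j] e] /= ij ji us0.
have <- : i = j.
  apply/val_inj/eqP; rewrite /= eqn_leq ij /=.
  by move: ji; rewrite leq_sub2lE // ltnW.
have munu : (mu <= nu)%MM.
  by apply/mnm_lepP => l; have := us0 l; rewrite (unsplitK (inl l)).
rewrite -(submK munu) addmC; exact: witt_shift_reach.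
Qed.

Definition witt_der (l : 'I_m) : C -> C := mderiv l.

Lemma witt_noeth : noeth witt_var [set: 'I_k -> W].
Proof.
apply: (@noethT C _ 'I_m ('I_k -> W) _ V witt_index_wf witt_der witt_var
  witt_shift _ _ _ _ _ witt_dickson).
- by move=> n; rewrite -mpolyC_nat mpolyC_eq0.
- by move=> l x y; apply: mderivD.
- by move=> l x y; rewrite /witt_der mderivM.
- by move=> l [mu i] a; rewrite /witt_der /witt_var /= mderivmDm mderivmU1m.
- move=> l [mu i]; rewrite ltxi_pair.
  rewrite /= lemc_addr /= ltxx implybF -ltNge lt_neqAle lemc_addr andbT.
  apply/eqP => /(congr1 (@mdeg m)); rewrite mdegD mdeg1 => /eqP.
  by rewrite -[X in X == _]addn0 eqn_add2l.
by move=> l [mu i] [nu j]; rewrite !ltxi_pair !lemc_add2l.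
Qed.

(** * Coordinates of term values as differential polynomials *)

Notation diffpoly := (dpol witt_var setT).

Definition coord_diffpoly (f : ('I_k -> W) -> W) : Prop :=
  forall j, diffpoly (fun a => f a j).

Lemma diffpoly_mderiv l f : diffpoly f -> diffpoly (fun a => mderiv l (f a)).
Proof.
apply: (@dpol_der _ _ _ _ _ witt_der _ witt_shift) => //.
- by move=> i x y; apply: mderivD.
- by move=> i x y; rewrite /witt_der mderivM.
by move=> i [mu j] a; rewrite /witt_der /witt_var /= mderivmDm mderivmU1m.
Qed.

Lemma coord_diffpoly_lsym_mul f g : coord_diffpoly f -> coord_diffpoly g ->
  coord_diffpoly (fun a => lsym_mul (f a) (g a)).
Proof.
move=> fP gP j.
have -> : (fun a => lsym_mul (f a) (g a) j)
    = fun a => \sum_(i < m) f a i * mderiv i (g a j).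
  by apply/funext => a; rewrite ffunE.
by apply: dpol_sum => i; apply: dpolM => //; apply: diffpoly_mderiv.
Qed.

Lemma coord_diffpolyB f g : coord_diffpoly f -> coord_diffpoly g ->
  coord_diffpoly (fun a => f a - g a).
Proof.
move=> fP gP j.
have -> : (fun a => (f a - g a) j) = fun a => f a j + - g a j.
  by apply/funext => a; rewrite !ffunE.
by apply: dpolD => //; apply: dpolN.
Qed.

(** Only the product case of the induction on terms depends on the algebra, so [mul] is left general
    to serve both Witt algebras. *)
Lemma coord_diffpoly_teval (mul : {bilinear W -> W -> W}) :
    (forall f g, coord_diffpoly f -> coord_diffpoly g ->
       coord_diffpoly (fun a => mul (f a) (g a))) ->
  forall t : nterm R (NAlgebra mul + 'I_k),
  coord_diffpoly (fun a => teval (@eval_val _ _ (NAlgebra mul) a) t).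
Proof.
move=> mulP; elim=> [[x|i]||s IHs t IHt|c t IHt|s IHs t IHt] /=.
- by move=> j; apply: (dpol_cst _ _ (x j)).
(* A coordinate of an unknown is its derivative of order zero. *)
- move=> j; have -> : (fun a : 'I_k -> W => a i j)
      = witt_var (0%MM, enum_rank (i, j)).
    by apply/funext => a; rewrite /witt_var /= enum_rankK mderivm0m.
  exact: dpol_var.
- move=> j; have -> : (fun a : 'I_k -> W => (0 : W) j) = fun=> 0.
    by apply/funext => a; rewrite ffunE.
  exact: dpol_cst.
- move=> j; move: (dpolD (IHs j) (IHt j)); congr dpol.
  by apply/funext => a; rewrite ffunE.
- move=> j; move: (dpolM (dpol_cst _ _ c%:MP) (IHt j)); congr dpol.
  by apply/funext => a; rewrite ffunE mul_mpolyC.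
exact: mulP.
Qed.

End Instance.

(** * Evaluation of elements of the coproduct *)

Lemma nalg_hom_comp (R : comNzRingType) (A B B' : nalgebra R) (f : A -> B)
    (g : B -> B') : nalg_hom f -> nalg_hom g -> nalg_hom (g \o f).
Proof.
by move=> [fL fM] [gL gM]; split=> [c u v|u v] /=; rewrite ?fL ?gL ?fM ?gM.
Qed.

Section Evaluation.
Context (R : comNzRingType) (E : set (nterm R nat)) (k : nat).
Context (A F D : nalgebra R) (z : 'I_k -> F) (inA : A -> D) (inF : F -> D).
Context (EA : in_variety E A) (Fz : is_free_algebra E z).
Context (Dco : is_coproduct E inA inF).

Lemma evaluation_exists (a : 'I_k -> A) :
  exists phi, is_evaluation inA (inF \o z) a phi.
Proof.
have [_ Fu] := Fz; have [_ _ _ Du] := Dco.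
have [g [[gH gz] _]] := Fu A EA a.
have [phi [[phiH phiA phiF] _]] := Du A EA _ _ (@nalg_hom_id R A) gH.
by exists phi; split=> // i /=; rewrite phiF gz.
Qed.

(** Freeness of [F] forces agreement after [inF], and the coproduct property then forces equality on
    [D]. *)
Lemma evaluation_unique (a : 'I_k -> A) (phi psi : D -> A) :
  is_evaluation inA (inF \o z) a phi -> is_evaluation inA (inF \o z) a psi ->
  phi = psi.
Proof.
have [_ Fu] := Fz; have [_ HA HF Du] := Dco.
move=> [phiH phiA phiz] [psiH psiA psiz].
have [g [[gH gz] gu]] := Fu A EA a.
have [chi [_ chiu]] := Du A EA _ _ (@nalg_hom_id R A) gH.
have phiF : phi \o inF = g.
  by apply/esym/gu; split=> //; apply: nalg_hom_comp.
have psiF : psi \o inF = g.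
  by apply/esym/gu; split=> //; apply: nalg_hom_comp.
have -> : phi = chi.
  by apply/esym/chiu; split=> // u; rewrite -phiF.
by apply/chiu; split=> // u; rewrite -psiF.
Qed.

(* D maps to the algebra of term classes over A and k generators, through which
   every evaluation factors. *)
Lemma evaluation_teval (f : D) :
  exists t : nterm R (A + 'I_k), forall (a : 'I_k -> A) (phi : D -> A),
  is_evaluation inA (inF \o z) a phi -> phi f = teval (eval_val a) t.
Proof.
have [_ Fu] := Fz; have [_ HA HF Du] := Dco.
pose P (B : nalgebra R) (h : A + 'I_k -> B) := nalg_hom (h \o inl).
pose T := pres_alg E P; have ET : in_variety E T by apply: pres_in_variety.
(* Equality in [T] is tested by assignments satisfying [P], which are homomorphisms on [A]. *)
have TA : nalg_hom (fun x : A => pres_gen E P (inl x)).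
  split=> [c u v|u v]; apply: pres_sep => B h EB Ph;
    have [lL lM] := pres_lift_hom EB Ph; have [hL hM] := Ph.
    by rewrite lL !pres_lift_gen //; apply: hL.
  by rewrite lM !pres_lift_gen //; apply: hM.
have [g [[gH gz] _]] := Fu T ET (fun i => pres_gen E P (inr i)).
have [h [[hH hA hF] _]] := Du T ET _ _ TA gH.
exists (pres_repr (h f)) => a phi phiP.
have Pa : P A (eval_val a) by split.
have lH : nalg_hom (pres_lift (E := E) (P := P) (eval_val a)).
  exact: pres_lift_hom.
rewrite (evaluation_unique (psi := pres_lift (eval_val a) \o h) phiP) //.
split=> [|x|i] /=; first exact: nalg_hom_comp.
  by rewrite hA pres_lift_gen.
by rewrite hF gz pres_lift_gen.
Qed.

End Evaluation.

(** * Separation of points from Zariski closed sets *)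

(** A basic neighbourhood of [a] avoiding [X] is a finite intersection of complements of zero loci.
    These loci cover [X], so the product of functions separating [a] from each of them vanishes on
    [X]; it is nonzero at [a] because [C] is a domain. *)
Lemma zariski_closed_sep (R : comNzRingType) (k : nat) (A D : nalgebra R)
    (inA : A -> D) (z : 'I_k -> D) (C : idomainType)
    (Q : set (('I_k -> A) -> C)) :
    Q (fun=> 1) -> (forall f g, Q f -> Q g -> Q (fun a => f a * g a)) ->
    (forall S a, ~ zero_locus inA z S a ->
       exists f, [/\ Q f, forall b, zero_locus inA z S b -> f b = 0
                   & f a != 0]) ->
  forall X : set (zariski_space inA z), closed X -> forall a, ~ X a ->
  exists f, [/\ Q f, forall b, X b -> f b = 0 & f a != 0].
Proof.
move=> Q1 QM Qsep X; rewrite -openC => /zariski_openE[U UfI UX] a nXa.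
have : (~` X) a by [].
rewrite -UX => -[W UW Wa]; have [J _ JW] := UfI _ UW.
have XW b : X b -> ~ W b.
  by move=> Xb Wb; have : (~` X) b by rewrite -UX; exists W.
have Ja S : S \in J -> ~ zero_locus inA z S a.
  by move=> SJ; move: Wa; rewrite -JW => /(_ S SJ).
have [f [Qf f0 fa]] : exists f, [/\ Q f,
    forall S b, S \in (J : seq _) -> zero_locus inA z S b -> f b = 0
    & f a != 0].
  have : forall S, S \in (J : seq _) -> ~ zero_locus inA z S a by exact: Ja.
  elim: (J : seq _) => [|S s IH] sa.
    by exists (fun=> 1); split=> //; apply: oner_neq0.
  have [|f [Qf f0 fa]] := IH.
    by move=> T Ts; apply: sa; rewrite inE Ts orbT.
  have [g [Qg g0 ga]] := Qsep S a (sa S (mem_head _ _)).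
  exists (fun b => g b * f b); split; [exact: QM| |exact: mulf_neq0].
  move=> T b; rewrite inE => /orP[/eqP -> /g0 ->|Ts Tb]; first by rewrite mul0r.
  by rewrite (f0 T b) // mulr0.
exists f; split=> // b /XW; rewrite -JW => nWb.
have [S SJ Sb] : exists2 S, S \in J & zero_locus inA z S b.
  apply: contrapT => nS; apply: nWb => S SJ Sb; apply: nS; by exists S.
exact: f0 Sb.
Qed.

Lemma witt_equationally_noetherian (R : idomainType) (m : nat)
    (mul : {bilinear witt_module m R -> witt_module m R -> witt_module m R}) :
    (forall n, n.+1%:R != 0 :> R) ->
    (forall k (f g : ('I_k -> witt_module m R) -> witt_module m R),
       coord_diffpoly f -> coord_diffpoly g ->
       coord_diffpoly (fun a => mul (f a) (g a))) ->
  equationally_noetherian (NAlgebra mul).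
Proof.
move=> charR mulP E EA k _ F z Fz D inA inF Dco _ _ X Xcl XS.
pose Q : set (('I_k -> witt_module m R) -> {mpoly R[m]}) :=
  dpol (@witt_var R m k) setT.
have Qsep S (a : 'I_k -> NAlgebra mul) : ~ zero_locus inA (inF \o z) S a ->
    exists f, [/\ Q f,
      forall b, zero_locus inA (inF \o z) S b -> f b = 0 & f a != 0].
  move=> nSa; have [phi phiP] := evaluation_exists EA Fz Dco a.
  have [d Sd phid] : exists2 d, S d & phi d <> 0.
    apply: contrapT => H; apply: nSa; exists phi => // d Sd.
    by apply: contrapT => ?; apply: H; exists d.
  have [t tP] := evaluation_teval EA Fz Dco d.
  have [j phij] : exists j, (phi d : witt_module m R) j != 0.
    apply: contrapT => H; apply: phid; apply/ffunP => j; rewrite ffunE.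
    by apply: contrapT => /eqP ?; apply: H; exists j.
  exists (fun b => (teval (eval_val b) t : witt_module m R) j); split.
  - exact: (coord_diffpoly_teval (mulP k) t j).
  - move=> b [psi psiP psi0]; rewrite -(tP _ _ psiP) psi0 //.
    by rewrite ffunE.
  - by rewrite -(tP _ _ phiP).
have sep n := zariski_closed_sep (dpol_cst _ _ 1) (@dpolM _ _ _ _ _ _)
  Qsep (Xcl n).
(* The descending chain of closed sets becomes an ascending chain of sets of differential
   polynomials; by [sep] each [X n] is exactly the set of zeros of [I n]. *)
pose I n := [set f | Q f /\ forall b, X n b -> f b = 0].
have XS' i j : (i <= j)%N -> X j `<=` X i.
  apply: (homo_leq (r := fun Y Z => Z `<=` Y)) => [Y|Y Z T YZ|//].
    exact: subset_refl.
  by move/subset_trans; apply.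
have [|i j ij f [Qf f0]|N NP] := @witt_noeth R m k charR I.
- by move=> n f [].
- by split=> // b /(XS' _ _ ij) /f0.
exists N => n Nn; apply/seteqP; split; first exact: XS'.
move=> a XNa; apply: contrapT => /(sep n)[f [Qf f0 /eqP]]; apply.
by apply: (NP a _ _ n) => // g [_]; apply.
Qed.

Theorem theorem4 (R : idomainType) (iota : {rmorphism rat -> R})
    (iota_inj : injective iota) (R_rad_noeth : radically_noetherian R)
    (m : nat) (m_gt0 : (0 < m)%N) :
  equationally_noetherian (lsym_witt m R) /\
  equationally_noetherian (witt m R).
Proof.
(* Characteristic 0, on which the separant argument rests, comes from the embedded rationals. *)
have charR n : n.+1%:R != 0 :> R.
  rewrite -(rmorph_nat iota) -(rmorph0 iota) (inj_eq iota_inj).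
  by rewrite Num.Theory.pnatr_eq0.
split; apply: witt_equationally_noetherian => // k f g fP gP.
  exact: coord_diffpoly_lsym_mul.
exact: coord_diffpolyB (coord_diffpoly_lsym_mul fP gP)
  (coord_diffpoly_lsym_mul gP fP).
Qed.
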